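(* Let $\lambda,\mu>0$, let $\mathbf e\in\mathbb R^3$ be a unit vector, and put $c_\mu=4(\mu^2-3\lambda^2)$, $c_\lambda=4(3\mu^2-\lambda^2)$. Then the function $$\mathbf u(x,t)=\frac{\lambda\cos(2\lambda(x-c_\lambda t))\cosh(2\mu(x-c_\mu t))-\mu\sin(2\lambda(x-c_\lambda t))\sinh(2\mu(x-c_\mu t))}{\dfrac{\lambda}{4\mu}\cosh^2(2\mu(x-c_\mu t))+\dfrac{\mu}{4\lambda}\sin^2(2\lambda(x-c_\lambda t))}\;\mathbf e,\qquad (x,t)\in\mathbb R^2,$$ is a solution of the vector modified Korteweg-de Vries equation $$\partial_t \mathbf u+6\,\mathbf u\times\partial_x^2\mathbf u+6\big(\mathbf u\,\partial_x|\mathbf u|^2-|\mathbf u|^2\,\partial_x\mathbf u\big)+\partial_x^3\mathbf u=0 .$$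
   Context: Here $\times$ is the vector (cross) product in $\mathbb R^3$ and $|\cdot|$ is the Euclidean norm. This is the breather-type solution. *)

(* Defs.v *)
From HB Require Import structures.
From mathcomp Require Import all_boot all_order all_algebra.
From mathcomp Require Import all_classical all_reals all_analysis.

Set Implicit Arguments.
Unset Strict Implicit.
Unset Printing Implicit Defensive.

Import Order.TTheory GRing.Theory Num.Theory.
Import numFieldNormedType.Exports.

Local Open Scope classical_set_scope.
Local Open Scope ring_scope.

Section Hyperbolic.
Context {R : realType}.

Definition cosh (x : R) : R := (expR x + expR (- x)) / 2.
Definition sinh (x : R) : R := (expR x - expR (- x)) / 2.

End Hyperbolic.

Section Euclidean3.
Context {R : realType}.

(* Indices are in 'I_3 with its addition modulo 3, so that coordinate i of
   the cross product is u_(i+1) v_(i+2) - u_(i+2) v_(i+1). *)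
Definition crossmul (u v : 'rV[R]_3) : 'rV[R]_3 :=
  \row_(i < 3) (u 0 (i + 1) * v 0 (i + 1 + 1) - u 0 (i + 1 + 1) * v 0 (i + 1)).

(* The norm `|u| that the library puts on 'rV[R]_3 is the sup norm. *)
Definition enorm (u : 'rV[R]_3) : R := Num.sqrt (\sum_(i < 3) u 0 i ^+ 2).

End Euclidean3.

Section PartialDerivatives.
Context {R : realType} {V : normedModType R}.

(* For u : R -> R -> V the first argument is x and the second one is t. *)
Definition partial_x (u : R -> R -> V) (x t : R) : V := derive1 (u ^~ t) x.
Definition partial_t (u : R -> R -> V) (x t : R) : V := derive1 (u x) t.

Definition ex_partial_x (u : R -> R -> V) : Prop :=
  forall x t, derivable (u ^~ t) x 1.
Definition ex_partial_t (u : R -> R -> V) : Prop :=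
  forall x t, derivable (u x) t 1.

Definition jointly_continuous (u : R -> R -> V) : Prop :=
  continuous (fun p : R * R => u p.1 p.2).

End PartialDerivatives.

Section VectorMKdV.
Context {R : realType}.
Implicit Type u : R -> R -> 'rV[R]_3.

Definition vmKdV_equation u (x t : R) : Prop :=
  partial_t u x t
  + 6 *: crossmul (u x t) (partial_x (partial_x u) x t)
  + 6 *: (partial_x (fun y s => enorm (u y s) ^+ 2 : R) x t *: u x t
          - enorm (u x t) ^+ 2 *: partial_x u x t)
  + partial_x (partial_x (partial_x u)) x t = 0.

(* Classical solution on the whole plane.  The derivatives [derive1] are total
   functions with default values, hence the explicit existence clauses. *)
Definition vmKdV_solution u : Prop :=
  [/\ [/\ ex_partial_t u, ex_partial_x u, ex_partial_x (partial_x u)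
        & ex_partial_x (partial_x (partial_x u))],
      [/\ jointly_continuous u,
          jointly_continuous (partial_t u),
          jointly_continuous (partial_x u),
          jointly_continuous (partial_x (partial_x u))
        & jointly_continuous (partial_x (partial_x (partial_x u)))]
    & forall x t, vmKdV_equation u x t].

End VectorMKdV.

(* Main.v *)
Require Import Defs.
From HB Require Import structures.
From mathcomp Require Import all_boot all_order all_algebra.
From mathcomp Require Import all_classical all_reals all_analysis.
From mathcomp Require Import ring lra.

Set Implicit Arguments.
Unset Strict Implicit.
Unset Printing Implicit Defensive.

Import Order.TTheory GRing.Theory Num.Theory.
Import numFieldNormedType.Exports.

Local Open Scope ring_scope.

(* The solution stays parallel to e, so the cross product vanishes and the
   equation becomes the scalar mKdV equation q_t + 6 q^2 q_x + q_xxx = 0.  The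
   breather is q = 2 (arctan (G / F))_x with F = lambda * cosh(...) and
   G = mu * sin(...).  With A = (2 lambda)^2 and B = (2 mu)^2, the verification
   uses only the linear equations F_xx = B F, F_t = - (B - 3 A) F_x,
   G_xx = - A G, G_t = - (3 B - A) G_x and the first integral
   F_x^2 + G_x^2 = B F^2 - A G^2. *)

(** * Differentiation rules on the line and joint continuity on the plane *)

Section PointwiseCalculus.
Local Open Scope classical_set_scope.
Local Open Scope ring_scope.
Context {R : realType}.
Implicit Types (f g : R -> R) (u v : R -> R -> R).

Lemma is_derive_cst_fun (x a : R) : is_derive x 1 (fun=> a) (0 : R).
Proof. exact: is_derive_cst. Qed.

Lemma is_derive_add f g (x df dg : R) :
  is_derive x 1 f df -> is_derive x 1 g dg ->
  is_derive x 1 (fun y => f y + g y) (df + dg).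
Proof. by move=> hf hg; exact: is_deriveD. Qed.

Lemma is_derive_opp f (x df : R) :
  is_derive x 1 f df -> is_derive x 1 (fun y => - f y) (- df).
Proof. by move=> hf; exact: is_deriveN. Qed.

Lemma is_derive_mul f g (x df dg : R) :
  is_derive x 1 f df -> is_derive x 1 g dg ->
  is_derive x 1 (fun y => f y * g y) (df * g x + f x * dg).
Proof.
move=> hf hg; apply: is_derive_eq (is_deriveM hf hg) _.
by rewrite /GRing.scale /=; ring.
Qed.

Lemma is_derive_sqr f (x df : R) :
  is_derive x 1 f df -> is_derive x 1 (fun y => f y ^+ 2) (2 * f x * df).
Proof.
move=> hf; rewrite (_ : (fun y => _) = fun y => f y * f y).
  by apply: is_derive_eq (is_derive_mul hf hf) _; ring.
by apply/funext => y; rewrite expr2.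
Qed.

Lemma is_derive_comp_fun f g (x df dg : R) :
  is_derive (f x) 1 g dg -> is_derive x 1 f df ->
  is_derive x 1 (fun y => g (f y)) (df * dg).
Proof. by move=> hg hf; rewrite mulrC; exact: is_derive1_comp. Qed.

(** The difference quotient of [f y *: e] is the scalar difference quotient of [f] times [e], and
    scaling a fixed vector is continuous in the scalar, so the limit passes through. *)
Lemma is_derive_scale_vec (V : normedModType R) (e : V) f (x df : R) :
  is_derive x 1 f df -> is_derive x 1 (fun y => f y *: e) (df *: e).
Proof.
move=> -[/cvg_ex[l fl] fdf].
have ldf : l = df by rewrite -fdf; apply/esym/cvg_lim.
have fe : (fun h => h^-1 *: (((fun y => f y *: e) \o shift x) (h *: (1 : R))
    - f x *: e)) @ 0^' --> df *: e.
  rewrite (_ : (fun h => _) =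
    fun h => (h^-1 *: ((f \o shift x) (h *: (1 : R)) - f x)) *: e).
    by rewrite -ldf; exact: cvgZr_tmp.
  by apply/funext => h; rewrite -scalerBl scalerA.
by split; [apply/cvg_ex; exists (df *: e)|exact: cvg_lim].
Qed.

Lemma is_derive_expRN (x : R) :
  is_derive x 1 (fun y : R => expR (- y)) (- expR (- x)).
Proof.
apply: is_derive_eq
  (is_derive_comp_fun (is_derive_expR _) (is_derive_opp (is_derive_id x 1))) _.
by rewrite mulN1r.
Qed.

Lemma is_derive_cosh (x : R) : is_derive x 1 (@cosh R) (sinh x).
Proof.
apply: is_derive_eq (is_derive_mul (is_derive_add (is_derive_expR x)
  (is_derive_expRN x)) (is_derive_cst_fun x 2^-1)) _.
by rewrite mulr0 addr0.
Qed.

Lemma is_derive_sinh (x : R) : is_derive x 1 (@sinh R) (cosh x).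
Proof.
apply: is_derive_eq (is_derive_mul (is_derive_add (is_derive_expR x)
  (is_derive_opp (is_derive_expRN x))) (is_derive_cst_fun x 2^-1)) _.
by rewrite mulr0 addr0 opprK.
Qed.

Lemma cosh2_sinh2 (x : R) : cosh x ^+ 2 - sinh x ^+ 2 = 1.
Proof.
have exN : expR x * expR (- x) = 1 by rewrite expRN mulfV // gt_eqF ?expR_gt0.
by rewrite /cosh /sinh; field: exN.
Qed.

Lemma cosh_gt0 (x : R) : 0 < cosh x.
Proof. by rewrite /cosh divr_gt0 // addr_gt0 ?expR_gt0. Qed.

Lemma continuous_of_is_derive f (df : R -> R) :
  (forall x : R, is_derive x 1 f (df x)) -> continuous f.
Proof.
move=> hf x; apply: differentiable_continuous; apply/derivable1_diffP.
by case: (hf x).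
Qed.

Lemma is_derive_phase_x (a c x t : R) :
  is_derive x 1 (fun y => a * (y - c * t)) a.
Proof.
apply: is_derive_eq (is_derive_mul (is_derive_cst_fun x a)
  (is_derive_add (is_derive_id x 1) (is_derive_cst_fun x (- (c * t))))) _.
by ring.
Qed.

Lemma is_derive_phase_t (a c x t : R) :
  is_derive t 1 (fun s => a * (x - c * s)) (- (c * a)).
Proof.
apply: is_derive_eq (is_derive_mul (is_derive_cst_fun t a)
  (is_derive_add (is_derive_cst_fun t x)
    (is_derive_opp (is_derive_mul (is_derive_cst_fun t c)
      (is_derive_id t 1))))) _.
by ring.
Qed.

Lemma jointly_continuous_cst (a : R) : jointly_continuous (fun _ _ : R => a).
Proof. by move=> p; exact: cvg_cst. Qed.

Lemma jointly_continuous_add u v : jointly_continuous u ->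
  jointly_continuous v -> jointly_continuous (fun x t => u x t + v x t).
Proof. by move=> hu hv p; apply: cvgD; [exact: hu|exact: hv]. Qed.

Lemma jointly_continuous_opp u : jointly_continuous u ->
  jointly_continuous (fun x t => - u x t).
Proof. by move=> hu p; apply: cvgN; exact: hu. Qed.

Lemma jointly_continuous_mul u v : jointly_continuous u ->
  jointly_continuous v -> jointly_continuous (fun x t => u x t * v x t).
Proof. by move=> hu hv p; apply: cvgM; [exact: hu|exact: hv]. Qed.

Lemma jointly_continuous_exp n u : jointly_continuous u ->
  jointly_continuous (fun x t => u x t ^+ n).
Proof.
move=> hu; elim: n => [|n ih]; first exact: jointly_continuous_cst.
rewrite (_ : (fun x t => _) = fun x t => u x t * u x t ^+ n).
  exact: jointly_continuous_mul.
by apply/funext => x; apply/funext => t; rewrite exprS.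
Qed.

Lemma jointly_continuous_inv u : (forall x t, u x t != 0) ->
  jointly_continuous u -> jointly_continuous (fun x t => (u x t)^-1).
Proof. by move=> u0 hu p; apply: cvgV; [exact: u0|exact: hu]. Qed.

Lemma jointly_continuous_comp f u : continuous f -> jointly_continuous u ->
  jointly_continuous (fun x t => f (u x t)).
Proof. by move=> hf hu p; apply: continuous_comp; [exact: hu|exact: hf]. Qed.

Lemma jointly_continuous_scale_vec (V : normedModType R) (e : V) u :
  jointly_continuous u -> jointly_continuous (fun x t => u x t *: e).
Proof. by move=> hu p; apply: cvgZr_tmp; exact: hu. Qed.

Lemma jointly_continuous_phase (a c : R) :
  jointly_continuous (fun x t : R => a * (x - c * t)).
Proof.
move=> p; apply: cvgM; first exact: cvg_cst.
apply: cvgB; first exact: cvg_fst.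
by apply: cvgM; [exact: cvg_cst|exact: cvg_snd].
Qed.

End PointwiseCalculus.

(** * Reduction of the vector equation to a scalar one along a fixed direction *)

Section ParallelSolutions.
Context {R : realType}.
Implicit Type e : 'rV[R]_3.

Lemma crossmul_parallel (a b : R) e : crossmul (a *: e) (b *: e) = 0.
Proof. by apply/rowP => i; rewrite !mxE; ring. Qed.

Lemma enorm_sqr (v : 'rV[R]_3) : enorm v ^+ 2 = \sum_(i < 3) v 0 i ^+ 2.
Proof. by rewrite sqr_sqrtr // sumr_ge0 // => i _; exact: sqr_ge0. Qed.

Lemma enorm_sqr_scale (a : R) e : enorm e = 1 -> enorm (a *: e) ^+ 2 = a ^+ 2.
Proof.
move=> e1; rewrite enorm_sqr -[RHS]mulr1 -[1 in RHS](expr1n _ 2) -e1 enorm_sqr.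
by rewrite mulr_sumr; apply: eq_bigr => i _; rewrite mxE exprMn.
Qed.

(** Concluding with an equality of functions, not of values at a point, allows rewriting inside a
    further [partial_x], as iterated derivatives require. *)
Lemma partial_x_is_derive (V : normedModType R) (u v : R -> R -> V) :
  (forall x t : R, is_derive x 1 (u ^~ t) (v x t)) -> partial_x u = v.
Proof.
move=> h; apply/funext => x; apply/funext => t.
by rewrite /partial_x derive1E; case: (h x t).
Qed.

Lemma partial_t_is_derive (V : normedModType R) (u v : R -> R -> V) :
  (forall x t : R, is_derive t 1 (u x) (v x t)) -> partial_t u = v.
Proof.
move=> h; apply/funext => x; apply/funext => t.
by rewrite /partial_t derive1E; case: (h x t).
Qed.

(** Since [e] is a unit vector, the squared norm is [q ^+ 2], and the bracket in the equation
    becomes [(2 q^2 q_x - q^2 q_x) e = q^2 q_x e], which produces the coefficient 6 of the scalar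
    equation. Explicit derivatives are supplied so that their existence and continuity transfer
    directly to the vector function. *)
Lemma vmKdV_solution_parallel e (q qt qx qxx qxxx : R -> R -> R) :
  enorm e = 1 ->
  (forall x t : R, is_derive t 1 (q x) (qt x t)) ->
  (forall x t : R, is_derive x 1 (q ^~ t) (qx x t)) ->
  (forall x t : R, is_derive x 1 (qx ^~ t) (qxx x t)) ->
  (forall x t : R, is_derive x 1 (qxx ^~ t) (qxxx x t)) ->
  jointly_continuous q -> jointly_continuous qt -> jointly_continuous qx ->
  jointly_continuous qxx -> jointly_continuous qxxx ->
  (forall x t, qt x t + 6 * q x t ^+ 2 * qx x t + qxxx x t = 0) ->
  vmKdV_solution (fun x t => q x t *: e).
Proof.
move=> e1 dt dx dxx dxxx cq ct cx cxx cxxx mKdV.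
have vt (x t : R) : is_derive t 1 (fun s => q x s *: e) (qt x t *: e).
  exact: is_derive_scale_vec.
have vx (x t : R) : is_derive x 1 (fun y => q y t *: e) (qx x t *: e).
  exact: (is_derive_scale_vec e (dx x t)).
have vxx (x t : R) : is_derive x 1 (fun y => qx y t *: e) (qxx x t *: e).
  exact: (is_derive_scale_vec e (dxx x t)).
have vxxx (x t : R) : is_derive x 1 (fun y => qxx y t *: e) (qxxx x t *: e).
  exact: (is_derive_scale_vec e (dxxx x t)).
have Et := partial_t_is_derive vt.
have Ex := partial_x_is_derive vx.
have Exx := partial_x_is_derive vxx.
have Exxx := partial_x_is_derive vxxx.
have En : partial_x (fun x t => enorm (q x t *: e) ^+ 2 : R)
    = fun x t => 2 * q x t * qx x t.
  apply: partial_x_is_derive => x t.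
  rewrite (_ : (fun y => _) = fun y => q y t ^+ 2).
    exact: (is_derive_sqr (dx x t)).
  by apply/funext => y; rewrite enorm_sqr_scale.
split.
- split=> [x t|x t|x t|x t]; rewrite ?Ex ?Exx.
  + by case: (vt x t).
  + by case: (vx x t).
  + by case: (vxx x t).
  + by case: (vxxx x t).
- by rewrite Et Ex Exx Exxx; split; exact: jointly_continuous_scale_vec.
- move=> x t; rewrite /vmKdV_equation En Et Ex Exx Exxx crossmul_parallel.
  rewrite enorm_sqr_scale // scaler0 addr0 !scalerA -scalerBl scalerA -!scalerDl.
  by rewrite -[RHS](scale0r e) -(mKdV x t); congr (_ *: _); ring.
Qed.

End ParallelSolutions.

(** * The scalar mKdV equation deduced from linear equations for two profiles *)

Ltac jointly_continuous_poly :=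
  lazymatch goal with
  | |- jointly_continuous (fun x t => @?u x t + @?v x t) =>
    apply (@jointly_continuous_add _ u v); jointly_continuous_poly
  | |- jointly_continuous (fun x t => - @?u x t) =>
    apply (@jointly_continuous_opp _ u); jointly_continuous_poly
  | |- jointly_continuous (fun x t => @?u x t * @?v x t) =>
    apply (@jointly_continuous_mul _ u v); jointly_continuous_poly
  | |- jointly_continuous (fun x t => @?u x t ^+ ?n) =>
    apply (@jointly_continuous_exp _ n u); jointly_continuous_poly
  | |- jointly_continuous (fun _ _ => ?a) => exact (@jointly_continuous_cst _ a)
  | |- _ => assumption
  end.

(** Here [f] and [g] are [F_x] and [G_x], and [cF], [cG] are the speeds of the two profiles. The
    time derivatives of [f] and [g] are hypotheses of their own, so no interchange of partial
    derivatives has to be justified. Everything then reduces to polynomial identities in [F], [f],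
    [G], [g] and one reciprocal. *)
Lemma vmKdV_solution_of_FG (R : realType) (e : 'rV[R]_3) (A B : R)
    (F f G g : R -> R -> R) :
  let cF := B - 3 * A in
  let cG := 3 * B - A in
  enorm e = 1 ->
  (forall x t : R, is_derive x 1 (F ^~ t) (f x t)) ->
  (forall x t : R, is_derive x 1 (f ^~ t) (B * F x t)) ->
  (forall x t : R, is_derive x 1 (G ^~ t) (g x t)) ->
  (forall x t : R, is_derive x 1 (g ^~ t) (- (A * G x t))) ->
  (forall x t : R, is_derive t 1 (F x) (- (cF * f x t))) ->
  (forall x t : R, is_derive t 1 (f x) (- (cF * (B * F x t)))) ->
  (forall x t : R, is_derive t 1 (G x) (- (cG * g x t))) ->
  (forall x t : R, is_derive t 1 (g x) (cG * (A * G x t))) ->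
  jointly_continuous F -> jointly_continuous f ->
  jointly_continuous G -> jointly_continuous g ->
  (forall x t, F x t ^+ 2 + G x t ^+ 2 != 0) ->
  (forall x t, f x t ^+ 2 + g x t ^+ 2 = B * F x t ^+ 2 - A * G x t ^+ 2) ->
  vmKdV_solution (fun x t =>
    (2 * (g x t * F x t - G x t * f x t) * (F x t ^+ 2 + G x t ^+ 2)^-1) *: e).
Proof.
move=> cF cG e1 dF df dG dg dFt dft dGt dgt contF contf contG contg D0 energy.
(* The solution is [2 N V], where [V] is the reciprocal of [D = F^2 + G^2], [N] is the Wronskian of
   [F] and [G], and [E] is half of [D_x]. Together with [M], [H = F G] and [h = H_x] below, these
   blocks keep the successive x-derivatives short. *)
pose V x t := (F x t ^+ 2 + G x t ^+ 2)^-1.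
pose N x t := g x t * F x t - G x t * f x t.
pose E x t := F x t * f x t + G x t * g x t.
pose M x t := B * F x t ^+ 2 - A * G x t ^+ 2.
have ME x t : M x t = f x t ^+ 2 + g x t ^+ 2 by rewrite energy.
pose K := A + B.
have contV : jointly_continuous V.
  by apply: (jointly_continuous_inv D0); jointly_continuous_poly.
have dV (x t : R) : is_derive x 1 (V ^~ t) (- 2 * E x t * V x t ^+ 2).
  apply: is_derive_eq; first exact: is_deriveV.
  by rewrite /GRing.scale /= exprVn /V /E; ring.
have dVt (x t : R) : is_derive t 1 (V x)
    (2 * (cF * F x t * f x t + cG * G x t * g x t) * V x t ^+ 2).
  apply: is_derive_eq; first exact: is_deriveV.
  by rewrite /GRing.scale /= exprVn /V; ring.
have contN : jointly_continuous N by rewrite /N; jointly_continuous_poly.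
have dN (x t : R) : is_derive x 1 (N ^~ t) (- K * F x t * G x t).
  by apply: is_derive_eq; rewrite /GRing.scale /= /K; ring.
(* The speeds give [cF B + cG A = K (B - A)] and [cG - cF = 2 K]. Compared with [N_x = - K H] and
   the derivatives of [H] and [h] below, this says [N_t = - N_xxx]: the numerator solves the linear
   part of the equation. *)
have dNt (x t : R) : is_derive t 1 (N x)
    (K * ((B - A) * F x t * G x t + 2 * f x t * g x t)).
  by apply: is_derive_eq; rewrite /GRing.scale /= /K /cF /cG; ring.
have contE : jointly_continuous E by rewrite /E; jointly_continuous_poly.
(* Differentiation gives [M + f^2 + g^2]; the first integral [ME] merges the two halves. *)
have dE (x t : R) : is_derive x 1 (E ^~ t) (2 * M x t).
  by apply: is_derive_eq; move: (ME x t); rewrite /GRing.scale /= /M => ME'; lra.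
have contM : jointly_continuous M by rewrite /M; jointly_continuous_poly.
have dM (x t : R) : is_derive x 1 (M ^~ t)
    (2 * (B * F x t * f x t - A * G x t * g x t)).
  by apply: is_derive_eq; rewrite /GRing.scale /=; ring.
pose H x t := F x t * G x t.
have contH : jointly_continuous H by rewrite /H; jointly_continuous_poly.
pose h x t := f x t * G x t + F x t * g x t.
have conth : jointly_continuous h by rewrite /h; jointly_continuous_poly.
have dH (x t : R) : is_derive x 1 (H ^~ t) (h x t).
  by apply: is_derive_eq; rewrite /GRing.scale /= /h; ring.
have dh (x t : R) : is_derive x 1 (h ^~ t)
    ((B - A) * H x t + 2 * f x t * g x t).
  by apply: is_derive_eq; rewrite /GRing.scale /= /H; ring.
(* The four further functions are the t-derivative and the first three x-derivatives of [2 N V],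
   collected by powers of [V]. *)
apply: (@vmKdV_solution_parallel _ e (fun x t => 2 * N x t * V x t)
  (fun x t => 2 * K * ((B - A) * H x t + 2 * f x t * g x t) * V x t
    + 4 * N x t * (cF * F x t * f x t + cG * G x t * g x t) * V x t ^+ 2)
  (fun x t => - 2 * K * H x t * V x t - 4 * N x t * E x t * V x t ^+ 2)
  (fun x t => - 2 * K * h x t * V x t
    + 8 * (K * H x t * E x t - N x t * M x t) * V x t ^+ 2
    + 16 * N x t * E x t ^+ 2 * (V x t ^+ 2 * V x t))
  (fun x t => - 2 * K * ((B - A) * H x t + 2 * f x t * g x t) * V x t
    + (12 * K * h x t * E x t + 24 * K * H x t * M x t
       - 16 * N x t * (B * F x t * f x t - A * G x t * g x t)) * V x t ^+ 2
    + (96 * N x t * E x t * M x t - 48 * K * H x t * E x t ^+ 2) * V x t ^+ 3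
    - 96 * N x t * E x t ^+ 3 * V x t ^+ 4) e1).
- by move=> x t; apply: is_derive_eq; rewrite /GRing.scale /= /H; ring.
- by move=> x t; apply: is_derive_eq; rewrite /GRing.scale /= /H; ring.
- by move=> x t; apply: is_derive_eq; rewrite /GRing.scale /= /H; ring.
- by move=> x t; apply: is_derive_eq; rewrite /GRing.scale /= /H; ring.
- by jointly_continuous_poly.
- by jointly_continuous_poly.
- by jointly_continuous_poly.
- by jointly_continuous_poly.
- by jointly_continuous_poly.
- move=> x t; rewrite ME.
  have VD : V x t * (F x t ^+ 2 + G x t ^+ 2) = 1 by rewrite /V mulVf.
  (* With D = F^2 + G^2 one has E^2 + N^2 = D * m: the terms of degree 3 and 4
     in V = 1 / D thus drop in degree by one, and then everything cancels. *)
  set m := f x t ^+ 2 + g x t ^+ 2.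
  transitivity ((1 - V x t * (F x t ^+ 2 + G x t ^+ 2)) *
    (96 * N x t * E x t * m * V x t ^+ 3 + 48 * K * H x t * m * V x t ^+ 2)).
    (* With [M] already replaced through the first integral, the identity is polynomial and holds
       for an arbitrary [v] in place of [V x t]. *)
    move: (V x t) => v {VD}.
    by rewrite /m /N /E /H /h /K /cF /cG; ring.
  by rewrite VD subrr mul0r.
Qed.

(** * The breather, from a hyperbolic and a trigonometric profile *)

Theorem mainTheorem4 (R : realType) (lambda mu : R) (e : 'rV[R]_3)
    (lambda_gt0 : 0 < lambda) (mu_gt0 : 0 < mu) (e_unit : enorm e = 1) :
  let c_mu := 4 * (mu ^+ 2 - 3 * lambda ^+ 2) in
  let c_lambda := 4 * (3 * mu ^+ 2 - lambda ^+ 2) in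
  vmKdV_solution (fun x t : R =>
    ((lambda * cos (2 * lambda * (x - c_lambda * t))
        * cosh (2 * mu * (x - c_mu * t))
      - mu * sin (2 * lambda * (x - c_lambda * t))
        * sinh (2 * mu * (x - c_mu * t)))
     / (lambda / (4 * mu) * cosh (2 * mu * (x - c_mu * t)) ^+ 2
        + mu / (4 * lambda) * sin (2 * lambda * (x - c_lambda * t)) ^+ 2))
    *: e).
Proof.
move=> c_mu c_lambda.
have la0 : lambda != 0 by rewrite gt_eqF.
have mu0 : mu != 0 by rewrite gt_eqF.
pose eta x t := 2 * mu * (x - c_mu * t).
pose theta x t := 2 * lambda * (x - c_lambda * t).
pose F x t := lambda * cosh (eta x t).
pose f x t := 2 * lambda * mu * sinh (eta x t).
pose G x t := mu * sin (theta x t).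
pose g x t := 2 * lambda * mu * cos (theta x t).
have D_gt0 x t : 0 < F x t ^+ 2 + G x t ^+ 2.
  by rewrite ltr_wpDr ?sqr_ge0 // exprn_gt0 // mulr_gt0 // cosh_gt0.
(* For [A = (2 lambda)^2] and [B = (2 mu)^2] the prescribed speeds are exactly [cF = B - 3 A] and
   [cG = 3 B - A]. *)
have cm : c_mu = (2 * mu) ^+ 2 - 3 * (2 * lambda) ^+ 2 by rewrite /c_mu; ring.
have cl : c_lambda = 3 * (2 * mu) ^+ 2 - (2 * lambda) ^+ 2.
  by rewrite /c_lambda; ring.
have contphase := @jointly_continuous_phase R.
have ccosh := continuous_of_is_derive (@is_derive_cosh R).
have csinh := continuous_of_is_derive (@is_derive_sinh R).
have dchx x t := is_derive_comp_fun (f := eta ^~ t) (is_derive_cosh (eta x t))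
  (is_derive_phase_x (2 * mu) c_mu x t).
have dshx x t := is_derive_comp_fun (f := eta ^~ t) (is_derive_sinh (eta x t))
  (is_derive_phase_x (2 * mu) c_mu x t).
have dsx x t := is_derive_comp_fun (f := theta ^~ t) (is_derive_sin (theta x t))
  (is_derive_phase_x (2 * lambda) c_lambda x t).
have dcx x t := is_derive_comp_fun (f := theta ^~ t) (is_derive_cos (theta x t))
  (is_derive_phase_x (2 * lambda) c_lambda x t).
have dcht x t := is_derive_comp_fun (is_derive_cosh (eta x t))
  (is_derive_phase_t (2 * mu) c_mu x t).
have dsht x t := is_derive_comp_fun (is_derive_sinh (eta x t))
  (is_derive_phase_t (2 * mu) c_mu x t).
have dst x t := is_derive_comp_fun (is_derive_sin (theta x t))
  (is_derive_phase_t (2 * lambda) c_lambda x t).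
have dct x t := is_derive_comp_fun (is_derive_cos (theta x t))
  (is_derive_phase_t (2 * lambda) c_lambda x t).
(* The given numerator is [(g F - G f) / (2 lambda mu)] and the given denominator is
   [(F^2 + G^2) / (4 lambda mu)]; their quotient leaves the factor 2. *)
rewrite (_ : (fun x t => _) = fun x t =>
  (2 * (g x t * F x t - G x t * f x t) * (F x t ^+ 2 + G x t ^+ 2)^-1) *: e);
  last first.
  apply/funext => x; apply/funext => t; congr (_ *: _).
  have := D_gt0 x t; rewrite /F /G /f /g /eta /theta.
  move: (cosh _) (sinh _) (cos _) (sin _) => C S c s D0.
  have D4 : lambda / (4 * mu) * C ^+ 2 + mu / (4 * lambda) * s ^+ 2
      = ((lambda * C) ^+ 2 + (mu * s) ^+ 2) / (4 * lambda * mu).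
    by field; rewrite la0 mu0.
  by rewrite D4; field; rewrite la0 mu0 gt_eqF.
apply: (@vmKdV_solution_of_FG _ e ((2 * lambda) ^+ 2) ((2 * mu) ^+ 2) F f G g e_unit);
  rewrite -?cm -?cl.
- move=> x t; apply: is_derive_eq
    (is_derive_mul (is_derive_cst_fun x lambda) (dchx x t)) _.
  by rewrite /f; ring.
- move=> x t; apply: is_derive_eq
    (is_derive_mul (is_derive_cst_fun x (2 * lambda * mu)) (dshx x t)) _.
  by rewrite /F; ring.
- move=> x t; apply: is_derive_eq
    (is_derive_mul (is_derive_cst_fun x mu) (dsx x t)) _.
  by rewrite /g; ring.
- move=> x t; apply: is_derive_eq
    (is_derive_mul (is_derive_cst_fun x (2 * lambda * mu)) (dcx x t)) _.
  by rewrite /G; ring.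
- move=> x t; apply: is_derive_eq
    (is_derive_mul (is_derive_cst_fun t lambda) (dcht x t)) _.
  by rewrite /f; ring.
- move=> x t; apply: is_derive_eq
    (is_derive_mul (is_derive_cst_fun t (2 * lambda * mu)) (dsht x t)) _.
  by rewrite /F; ring.
- move=> x t; apply: is_derive_eq
    (is_derive_mul (is_derive_cst_fun t mu) (dst x t)) _.
  by rewrite /g; ring.
- move=> x t; apply: is_derive_eq
    (is_derive_mul (is_derive_cst_fun t (2 * lambda * mu)) (dct x t)) _.
  by rewrite /G; ring.
- apply: jointly_continuous_mul; first exact: jointly_continuous_cst.
  exact: (jointly_continuous_comp ccosh (contphase _ _)).
- apply: jointly_continuous_mul; first exact: jointly_continuous_cst.
  exact: (jointly_continuous_comp csinh (contphase _ _)).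
- apply: jointly_continuous_mul; first exact: jointly_continuous_cst.
  exact: (jointly_continuous_comp (@continuous_sin R) (contphase _ _)).
- apply: jointly_continuous_mul; first exact: jointly_continuous_cst.
  exact: (jointly_continuous_comp (@continuous_cos R) (contphase _ _)).
- by move=> x t; rewrite gt_eqF.
(* After division by [4 lambda^2 mu^2] the first integral reads [sinh^2 + cos^2 = cosh^2 - sin^2],
   which follows from the two Pythagorean identities. *)
- move=> x t; rewrite /F /G /f /g.
  have := cosh2_sinh2 (eta x t); have := cos2Dsin2 (theta x t).
  move: (cosh _) (sinh _) (cos _) (sin _) => C S c s cs CS.
  have c2 : c ^+ 2 = 1 - s ^+ 2 by rewrite -cs addrK.
  have C2 : C ^+ 2 = 1 + S ^+ 2 by rewrite -CS subrK.
  by ring: c2 C2.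
Qed.
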